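(* There exist an integer $d\ge 1$ and a hypergraph $G$ on $d$ vertices whose quantum hypergraph state $|G\rangle\in\mathbb{C}^{2^d}$ is squeezed in the phase quadrature only, i.e. squeezed with respect to the phase operator $\hat P$ and not squeezed with respect to the number operator $\hat N$: $$\langle(\Delta\hat P)^2\rangle<\tfrac12\,\bigl|\langle[\hat N,\hat P]\rangle\bigr|\qquad\text{and}\qquad \langle(\Delta\hat N)^2\rangle\ \ge\ \tfrac12\,\bigl|\langle[\hat N,\hat P]\rangle\bigr| ,$$ where all expectation values and variances are taken in the state $|G\rangle$.
   Context: Hypergraphs: a hypergraph $G=(V(G),E(G))$ on $d$ vertices has vertex set $V(G)=\{1,\dots,d\}$, and $E(G)$ is a set of subsets of $V(G)$, each with at least two elements, at least one of which has more than two elements. Hypergraph state: let $\{|n\rangle : n=0,1,\dots,2^d-1\}$ be the standard orthonormal basis of $\mathbb{C}^{2^d}$ (the number states). Write $n$ in binary as $n=\sum_{i=1}^{d}x_i2^{d-i}$ with $x_i\in\{0,1\}$ (vertex $1$ corresponds to the most significant bit), and set $f(n)=\sum_{e\in E(G)}\prod_{i\in e}x_i \pmod 2$. The quantum hypergraph state of $G$ is $$|G\rangle=\frac{1}{\sqrt{2^d}}\sum_{n=0}^{2^d-1}(-1)^{f(n)}|n\rangle .$$ Number and phase operators: the number operator is $\hat N=\sum_{n=0}^{2^d-1}n\,|n\rangle\langle n|$. For $m=0,\dots,2^d-1$ put $\theta_m=2\pi m/2^d$ and define the phase states $|\theta_m\rangle=\frac{1}{\sqrt{2^d}}\sum_{n=0}^{2^d-1}e^{\mathrm{i}\theta_m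 n}|n\rangle$, which form an orthonormal basis of $\mathbb{C}^{2^d}$. The phase operator is $\hat P=\sum_{m=0}^{2^d-1}\theta_m|\theta_m\rangle\langle\theta_m|$. Expectations and squeezing: for an operator $\hat A$ on $\mathbb{C}^{2^d}$, $\langle\hat A\rangle=\langle G|\hat A|G\rangle$ and $\langle(\Delta\hat A)^2\rangle=\langle\hat A^2\rangle-\langle\hat A\rangle^2$; $[\hat A,\hat B]=\hat A\hat B-\hat B\hat A$. For the pair $(\hat N,\hat P)$, the state $|G\rangle$ is squeezed with respect to $\hat A\in\{\hat N,\hat P\}$ if $\langle(\Delta\hat A)^2\rangle<\frac12|\langle[\hat N,\hat P]\rangle|$. *)

(* Defs.v *)
From mathcomp Require Import all_boot all_order all_algebra.
From mathcomp Require Import complex.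
From mathcomp Require Import reals trigo.

Set Implicit Arguments.
Unset Strict Implicit.
Unset Printing Implicit Defensive.

Import Order.TTheory GRing.Theory Num.Theory.

Local Open Scope ring_scope.
Local Open Scope complex_scope.
Local Open Scope sesquilinear_scope.

(* The vertices 1, ..., d are represented by 'I_d: the ordinal i stands for
   vertex i.+1. *)
Record hypergraph (d : nat) := Hypergraph {
  edges : {set {set 'I_d}};
  edges_gt1 : forall e, e \in edges -> (1 < #|e|)%N;
  edges_hyper : exists2 e, e \in edges & (2 < #|e|)%N
}.

(* n = \sum_(i < d) bit d n i * 2 ^ (d - i.+1) for n < 2 ^ d, so ord0, i.e.
   vertex 1, carries the most significant bit. *)
Definition bit (d n : nat) (i : 'I_d) : nat := odd (n %/ 2 ^ (d - i.+1))%N.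

Definition hypergraph_fun (d : nat) (G : hypergraph d) (n : nat) : nat :=
  ((\sum_(e in edges G) \prod_(i in e) bit n i) %% 2)%N.

Section QuantumMechanics.
Variables (R : realType) (D : nat).
Implicit Types (psi : 'cV[R[i]]_D) (A B : 'M[R[i]]_D).

Definition expectation psi A : R[i] := (psi ^t* *m A *m psi) 0 0.

Definition variance psi A : R[i] :=
  expectation psi (A *m A) - expectation psi A ^+ 2.

Definition commutator A B : 'M[R[i]]_D := A *m B - B *m A.

Definition uncertainty_bound psi A B : R[i] :=
  2^-1 * `|expectation psi (commutator A B)|.

(* psi is squeezed with respect to C, for the pair (A, B).  The order of R[i]
   is the partial one: x < y (resp. x <= y) means that y - x is a positive
   (resp. nonnegative) real.  The bound is real, so both inequalities also
   assert that the variance is real, as it is for Hermitian C and unit psi. *)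
Definition squeezed psi A B (C : 'M[R[i]]_D) : Prop :=
  variance psi C < uncertainty_bound psi A B.

Definition ketbra psi : 'M[R[i]]_D := psi *m psi ^t*.

End QuantumMechanics.

Section NumberPhase.
Variables (R : realType) (d : nat).

Definition number_state (n : 'I_(2 ^ d)) : 'cV[R[i]]_(2 ^ d) := delta_mx n 0.

Definition hypergraph_state (G : hypergraph d) : 'cV[R[i]]_(2 ^ d) :=
  (sqrtC (2 ^ d)%:R)^-1 *:
    \sum_(n < 2 ^ d) (-1) ^+ hypergraph_fun G n *: number_state n.

Definition number_op : 'M[R[i]]_(2 ^ d) :=
  \sum_(n < 2 ^ d) n%:R *: ketbra (number_state n).

Definition expi (t : R) : R[i] := cos t +i* sin t.

Definition theta (m : nat) : R := 2 * pi * m%:R / (2 ^ d)%:R.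

Definition phase_state (m : nat) : 'cV[R[i]]_(2 ^ d) :=
  (sqrtC (2 ^ d)%:R)^-1 *:
    \sum_(n < 2 ^ d) expi (theta m * n%:R) *: number_state n.

Definition phase_op : 'M[R[i]]_(2 ^ d) :=
  \sum_(m < 2 ^ d) (theta m)%:C *: ketbra (phase_state m).

End NumberPhase.

(* Main.v *)
(* On d = 4 vertices take the single edge {1, 2, 3, 4}.  Only the basis vector
   |15> gets a sign, so |G> = |theta_0> - 1/2 |15>, whence <theta_m|G> has
   squared modulus 1/64 for every m <> 0.  As theta_0 = 0, this gives
   Var P = 1015/4096 pi^2, while Var N = 85/4.  The overlaps also give
   <[N, P]> = - i pi T / 512, where T = sum_(m, n < 16) m n sin(pi m (n+1) / 8).
   Reducing the angles modulo 2 pi,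
   T = 192 + 512 (cos(pi/4) + cos(pi/8)) = 1027.0...,
   so that pi < 4 already yields Var P < pi T / 1024 < Var N. *)
Require Import Defs.
From mathcomp Require Import all_boot all_order all_algebra.
From mathcomp Require Import complex.
From mathcomp Require Import reals trigo.
From mathcomp Require Import ring lra.

Set Implicit Arguments.
Unset Strict Implicit.
Unset Printing Implicit Defensive.

Import Order.TTheory GRing.Theory Num.Theory.

Local Open Scope ring_scope.
Local Open Scope sesquilinear_scope.

(** * Expectations and commutators of operators given as weighted sums of projectors *)

Section Spectral.
Variables (R : realType) (D : nat) (I : finType).
Local Notation C := R[i].
Implicit Types (u v psi : 'cV[C]_D) (A B : 'M[C]_D).

Definition braket u v : C := (u ^t* *m v) 0 0.

Lemma braketE u v : braket u v = \sum_n (u n 0)^* * v n 0.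
Proof. by rewrite /braket mxE; apply: eq_bigr => n _; rewrite !mxE. Qed.

Lemma braket_conj u v : (braket u v)^* = braket v u.
Proof.
rewrite !braketE rmorph_sum; apply: eq_bigr => n _.
by rewrite rmorphM /= conjCK mulrC.
Qed.

Lemma braketBr u v w : braket u (v - w) = braket u v - braket u w.
Proof. by rewrite /braket mulmxBr !mxE. Qed.

Lemma braketZr c u v : braket u (c *: v) = c * braket u v.
Proof. by rewrite /braket -scalemxAr mxE. Qed.

Lemma ketbra_mul u v : ketbra u *m v = braket u v *: u.
Proof. by rewrite /ketbra -mulmxA [_ *m v]mx11_scalar mul_mx_scalar. Qed.

Lemma expectationE psi A : expectation psi A = braket psi (A *m psi).
Proof. by rewrite /expectation /braket mulmxA. Qed.

Variables (a : I -> C) (e : I -> 'cV[C]_D).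
Local Notation A := (\sum_i a i *: ketbra (e i)).

Lemma braket_sum_ketbra u v :
  braket u (A *m v) = \sum_i a i * (braket u (e i) * braket (e i) v).
Proof.
rewrite /braket mulmx_suml mulmx_sumr summxE; apply: eq_bigr => i _.
by rewrite -scalemxAl ketbra_mul -!scalemxAr 2!mxE [braket _ v * _]mulrC.
Qed.

Lemma expectation_sum_ketbra psi :
  expectation psi A = \sum_i a i * `|braket (e i) psi| ^+ 2.
Proof.
rewrite expectationE braket_sum_ketbra; apply: eq_bigr => i _.
by rewrite normCK braket_conj [in RHS]mulrC [RHS]mulrC [braket _ psi * _]mulrC.
Qed.

Hypothesis orthonormal_e : forall i j, braket (e i) (e j) = (i == j)%:R.

(** By orthonormality only the [i]-th term survives: [e i] is a left eigenvector of the sum, which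
    turns the weights of its square into [a i ^+ 2]. *)
Lemma braket_eigenvector i psi :
  braket (e i) (A *m psi) = a i * braket (e i) psi.
Proof.
rewrite braket_sum_ketbra (bigD1 i) //= orthonormal_e eqxx mul1r big1 ?addr0 //.
by move=> j jNi; rewrite orthonormal_e eq_sym (negPf jNi) mul0r mulr0.
Qed.

Lemma expectation_sum_ketbra_sqr psi :
  expectation psi (A *m A) = \sum_i a i ^+ 2 * `|braket (e i) psi| ^+ 2.
Proof.
rewrite expectationE -mulmxA braket_sum_ketbra; apply: eq_bigr => i _.
by rewrite braket_eigenvector normCK braket_conj expr2; ring.
Qed.

(** Only the spectral form of the second operator is expanded. For Hermitian [B] the two products in
    each summand are conjugate, so their difference is [2 * 'i] times an imaginary part. *)
Lemma expectation_commutator psi B :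
  expectation psi (commutator B A) =
  \sum_i a i * (braket psi (B *m e i) * braket (e i) psi -
                braket psi (e i) * braket (e i) (B *m psi)).
Proof.
rewrite expectationE /commutator mulmxBl -!mulmxA /braket mulmxBr mxE.
rewrite [X in _ + X]mxE -/(braket _ _) -/(braket _ (A *m _)) braket_sum_ketbra.
under [RHS]eq_bigr do rewrite mulrBr.
rewrite big_split sumrN /=; congr (_ - _).
rewrite /braket mulmx_suml !mulmx_sumr summxE; apply: eq_bigr => i _.
by rewrite -scalemxAl ketbra_mul -!scalemxAr 2!mxE [braket _ psi * _]mulrC.
Qed.

End Spectral.

(** * The number operator in the standard basis *)

Section NumberOperator.
Variables (R : realType) (d : nat).
Local Notation C := R[i].
Implicit Types (psi v : 'cV[C]_(2 ^ d)) (m n : 'I_(2 ^ d)).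

Lemma braket_number_state m v : braket (number_state R m) v = v m 0.
Proof.
rewrite braketE (bigD1 m) //= big1 ?addr0; last first.
  by move=> n nNm; rewrite !mxE (negPf nNm) rmorph0 mul0r.
by rewrite !mxE !eqxx rmorph1 mul1r.
Qed.

Lemma number_state_orthonormal m n :
  braket (number_state R m) (number_state R n) = (m == n)%:R.
Proof. by rewrite braket_number_state mxE eqxx andbT. Qed.

Lemma number_op_mul psi n : (number_op R d *m psi) n 0 = n%:R * psi n 0.
Proof.
rewrite -[LHS]braket_number_state braket_eigenvector ?braket_number_state //.
exact: number_state_orthonormal.
Qed.

Lemma number_op_hermitian u v :
  (braket u (number_op R d *m v))^* = braket v (number_op R d *m u).
Proof.
rewrite !braketE rmorph_sum; apply: eq_bigr => n _.
by rewrite !number_op_mul !rmorphM /= conjCK rmorph_nat; ring.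
Qed.

Lemma variance_number_op psi :
  variance psi (number_op R d) =
  \sum_(n < 2 ^ d) n%:R ^+ 2 * `|psi n 0| ^+ 2 -
  (\sum_(n < 2 ^ d) n%:R * `|psi n 0| ^+ 2) ^+ 2.
Proof.
rewrite /variance expectation_sum_ketbra_sqr; last first.
  exact: number_state_orthonormal.
rewrite expectation_sum_ketbra.
by congr (_ - _ ^+ 2); apply: eq_bigr => n _; rewrite braket_number_state.
Qed.

End NumberOperator.

(** * Complex exponentials and orthonormality of the phase states *)

Section PhaseStates.
Variable R : realType.
Local Notation C := R[i].

Lemma expiD (s t : R) : expi (s + t) = expi s * expi t.
Proof.
apply/eqP; rewrite eq_complex /= cosD sinD eqxx /=.
by rewrite addrC [cos s * _]mulrC [sin s * _]mulrC.
Qed.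

Lemma expi0 : expi (0 : R) = 1.
Proof. by rewrite /expi cos0 sin0. Qed.

Lemma conj_expi (t : R) : (expi t)^* = expi (- t).
Proof. by rewrite /expi cosN sinN. Qed.

Lemma expiMn (t : R) k : expi (t *+ k) = expi t ^+ k.
Proof. by elim: k => [|k IHk]; rewrite ?expi0 // mulrS expiD IHk exprS. Qed.

Lemma expi2piMn k : expi (2 * pi * k%:R : R) = 1.
Proof. by rewrite mulr_natr expiMn mulr_natl /expi cos2pi sin2pi expr1n. Qed.

Lemma expi_conjK (t : R) : expi t * (expi t)^* = 1.
Proof. by rewrite conj_expi -expiD subrr expi0. Qed.

(** The half-angle formula [cos t = 1 - 2 * sin (t / 2) ^+ 2] puts the real part strictly below 1,
    because [t / 2] lies strictly between 0 and [pi]. *)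
Lemma expi_neq1 (t : R) : 0 < t < 2 * pi -> expi t != 1.
Proof.
move=> /andP[t_gt0 t_lt]; apply/eqP => -[cost _].
have sin_gt0 : 0 < sin (t / 2) by rewrite sin_gt0_pi// divr_gt0//=; lra.
have : t = (t / 2) *+ 2 by rewrite -mulr_natr; field.
move=> tE; move: cost; rewrite tE cos_mulr2n cos2sin2 => cost.
by have := exprn_gt0 2 sin_gt0; rewrite mulr2n in cost; lra.
Qed.

Variable d : nat.
Local Notation D := (2 ^ d)%N.

Lemma pow2_neq0 (F : numDomainType) : D%:R != 0 :> F.
Proof. by rewrite pnatr_eq0 expn_eq0. Qed.

Lemma expi_theta_period m : expi (theta R d m) ^+ D = 1.
Proof.
by rewrite -expiMn -mulr_natr /theta divfK ?pow2_neq0 // expi2piMn.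
Qed.

(** For [m != n] this is a geometric sum whose ratio [z] satisfies [z ^+ D = 1], so it vanishes once
    [z != 1]. *)
Lemma sum_expi_theta (m n : 'I_D) :
  \sum_(k < D) (expi (theta R d m * k%:R))^* * expi (theta R d n * k%:R) =
  D%:R * (m == n)%:R.
Proof.
have [->|mNn] := eqVneq m n.
  under eq_bigr do rewrite mulrC expi_conjK.
  by rewrite sumr_const card_ord mulr1.
set z : C := (expi (theta R d m))^* * expi (theta R d n).
have -> : \sum_(k < D) (expi (theta R d m * k%:R))^* * expi (theta R d n * k%:R)
          = \sum_(k < D) z ^+ k.
  by apply: eq_bigr => k _; rewrite !mulr_natr !expiMn rmorphXn -exprMn.
have zD : z ^+ D = 1.
  by rewrite exprMn -rmorphXn !expi_theta_period rmorph1 mul1r.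
rewrite mulr0; apply/eqP.
have /eqP := subrX1 z D; rewrite zD subrr eq_sym mulf_eq0 subr_eq0.
case/orP => // /eqP z1; exfalso.
have e_mn : expi (theta R d m) = expi (theta R d n).
  by rewrite -[LHS]mulr1 -z1 /z mulrA expi_conjK mul1r.
(* Ordering the indices makes [n - m] a genuine natural difference, whose angle lies strictly
   between 0 and [2 * pi]. *)
wlog lt_mn : m n {z zD z1} mNn e_mn / (m < n)%N.
  move=> wlt; have [lt_mn|lt_nm|eq_mn] := ltngtP m n.
  - exact: (wlt m n).
  - by apply: (wlt n m); rewrite // eq_sym.
  - by move/eqP: mNn; apply; apply: val_inj.
have : expi (theta R d (n - m)) != 1.
  have D_gt0 : 0 < D%:R :> R by rewrite ltr0n expn_gt0.
  apply: expi_neq1; rewrite /theta divr_gt0 ?mulr_gt0 ?pi_gt0 //=; last first.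
    by rewrite ltr0n subn_gt0.
  rewrite ltr_pdivrMr // ltr_pM2l ?mulr_gt0 ?pi_gt0 // ltr_nat.
  by rewrite (leq_ltn_trans (leq_subr _ _)).
suff -> : theta R d (n - m) = theta R d n - theta R d m.
  by rewrite expiD -conj_expi e_mn expi_conjK eqxx.
by rewrite /theta natrB ?(ltnW lt_mn)//; ring.
Qed.

Lemma phase_stateE m (n : 'I_D) :
  phase_state R d m n 0 = (sqrtC D%:R)^-1 * expi (theta R d m * n%:R).
Proof.
rewrite mxE summxE (bigD1 n) //= !mxE !eqxx big1 ?addr0 ?mulr1 //.
by move=> k kNn; rewrite !mxE eq_sym (negPf kNn) mulr0.
Qed.

Lemma invsqrtC_nat_conj k : ((sqrtC k%:R : C)^-1)^* = (sqrtC k%:R)^-1.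
Proof. by rewrite fmorphV /= geC0_conj // sqrtC_ge0 ler0n. Qed.

Lemma invsqrtC_sqr (x : C) : (sqrtC x)^-1 * (sqrtC x)^-1 = x^-1.
Proof. by rewrite -invfM -expr2 sqrtCK. Qed.

Lemma phase_state_orthonormal (m n : 'I_D) :
  braket (phase_state R d m) (phase_state R d n) = (m == n)%:R.
Proof.
rewrite braketE.
under eq_bigr do rewrite !phase_stateE rmorphM /= invsqrtC_nat_conj mulrACA
  invsqrtC_sqr.
by rewrite -mulr_sumr sum_expi_theta mulKf ?pow2_neq0.
Qed.

Lemma expectation_phase_op psi :
  expectation psi (phase_op R d) =
  \sum_(m < D) (theta R d m)%:C%C * `|braket (phase_state R d m) psi| ^+ 2.
Proof. exact: expectation_sum_ketbra. Qed.

Lemma expectation_phase_op_sqr psi :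
  expectation psi (phase_op R d *m phase_op R d) =
  \sum_(m < D) (theta R d m)%:C%C ^+ 2 *
    `|braket (phase_state R d m) psi| ^+ 2.
Proof. exact/expectation_sum_ketbra_sqr/phase_state_orthonormal. Qed.

End PhaseStates.

(** * Evaluation and bounds of the double sine sum behind the commutator *)

Section WeightedSineSum.
Variable R : realType.

(** For [d = 4] every phase is a multiple of [pi / 8]. Indexing by a natural number lets angles be
    reduced by computing modulo 16. *)
Definition sin8 (k : nat) : R := sin (pi / 8 * k%:R).

Lemma sin8D16 j k : sin8 (16 * j + k) = sin8 k.
Proof.
rewrite /sin8; elim: j => [//|j <-].
rewrite (_ : (16 * j.+1 + k = 16 + (16 * j + k))%N); last first.
  by rewrite mulnS addnA.
rewrite [in LHS]natrD mulrDr addrC (_ : pi / 8 * 16%:R = pi *+ 2) ?sinD2pi //.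
by rewrite -mulr_natr; field.
Qed.

Lemma sin8_modn k : sin8 (k %% 16) = sin8 k.
Proof. by rewrite [in RHS](divn_eq k 16) mulnC sin8D16. Qed.

Lemma sin8D8 k : sin8 (8 + k) = - sin8 k.
Proof.
by rewrite /sin8 natrD mulrDr addrC divfK ?pnatr_eq0 // sinDpi.
Qed.

Lemma sin8B8 k : (k <= 8)%N -> sin8 (8 - k) = sin8 k.
Proof.
move=> le_k8; rewrite /sin8 natrB // mulrBr divfK ?pnatr_eq0 //.
by rewrite addrC sinDpi sinN opprK.
Qed.

Lemma sum_sin8 :
  \sum_(m < 16) \sum_(n < 16) (m * n)%:R * sin8 (m * n.+1) =
  192 + 512 * (sin8 2 + sin8 3).
Proof.
(* [c k] is the coefficient of [sin8 k] once angles are reduced modulo 2 pi;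
   the symmetries of the sine then leave only [sin8 2], [sin8 3], [sin8 4]. *)
pose c (k : nat) := (\sum_(0 <= m < 16) \sum_(0 <= n < 16)
   if m * n.+1 %% 16 == k then m * n else 0)%N.
transitivity (\sum_(k < 16) (c k)%:R * sin8 k).
  have red m n : (m * n)%:R * sin8 (m * n.+1) = \sum_(k < 16)
      (if m * n.+1 %% 16 == k then m * n else 0)%N%:R * sin8 k.
    have lt16 : (m * n.+1 %% 16 < 16)%N by rewrite ltn_mod.
    rewrite (bigD1 (Ordinal lt16)) //= eqxx sin8_modn big1 ?addr0 // => k.
    by rewrite -val_eqE /= eq_sym => /negPf ->; rewrite mul0r.
  under eq_bigr do (under eq_bigr do rewrite red; rewrite exchange_big /=).
  rewrite exchange_big; apply: eq_bigr => k _ /=.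
  rewrite /c big_mkord natr_sum mulr_suml; apply: eq_bigr => m _.
  by rewrite big_mkord natr_sum mulr_suml.
have cE k : (k < 16)%N -> c k = nth 0%N
    [:: 2752; 488; 1056; 600; 1440; 552; 992; 408;
        1792; 488; 800; 344; 1248; 296; 736; 408]%N k.
  (* Unlocking the big operators leaves closed natural-number sums to evaluate. *)
  do 16 (case: k => [_|k]; first by rewrite /c unlock; vm_compute).
  by [].
under eq_bigr => k _ do rewrite cE //.
rewrite !big_ord_recr big_ord0 /=.
have sin8_0 : sin8 0 = 0 by rewrite /sin8 mulr0 sin0.
have sin8_4 : sin8 4 = 1.
  by rewrite /sin8 (_ : _ * _ = pi / 2) ?sin_pihalf //; field.
(* After folding, the coefficient of [sin8 1] is [488 + 408 - 488 - 408 = 0], those of [sin8 2] and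
   [sin8 3] are both 512, and that of [sin8 4] is [1440 - 1248 = 192]. *)
rewrite (sin8D8 0 : sin8 8 = - sin8 0) (sin8D8 1 : sin8 9 = - sin8 1)
  (sin8D8 2 : sin8 10 = - sin8 2) (sin8D8 3 : sin8 11 = - sin8 3)
  (sin8D8 4 : sin8 12 = - sin8 4) (sin8D8 5 : sin8 13 = - sin8 5)
  (sin8D8 6 : sin8 14 = - sin8 6) (sin8D8 7 : sin8 15 = - sin8 7)
  (@sin8B8 3 isT : sin8 5 = sin8 3) (@sin8B8 2 isT : sin8 6 = sin8 2)
  (@sin8B8 1 isT : sin8 7 = sin8 1).
by rewrite sin8_0 sin8_4; ring.
Qed.

(** The lower bound is what the comparison with [1015 / 4 * pi] requires when only [pi < 4] is
    known. The upper bound replaces both sines by 1. *)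
Lemma sum_sin8_bounds :
  1015 < \sum_(m < 16) \sum_(n < 16) (m * n)%:R * sin8 (m * n.+1) <= 1216.
Proof.
have cos_sin8 k : (k <= 4)%N -> sin8 (4 - k) = cos (pi / 8 * k%:R).
  move=> le_k4; rewrite /sin8 natrB // -cosBpihalf -cosN; congr cos.
  by field.
have pi_gt0 := pi_gt0 R.
have cos_gt0 k : (0 < k < 4)%N -> 0 < cos (pi / 8 * k%:R : R).
  move=> /andP[k_gt0 lt_k4]; apply: cos_gt0_pihalf.
  have : 0 < pi * (4 - k%:R) :> R by rewrite mulr_gt0 // subr_gt0 ltr_nat.
  have : 0 < pi * k%:R :> R by rewrite mulr_gt0 // ltr0n.
  by move=> *; apply/andP; split; lra.
have := cos_gt0 1%N isT; have := cos_gt0 2%N isT.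
rewrite sum_sin8 (cos_sin8 1%N isT) (cos_sin8 2%N isT).
(* With [s = cos (pi / 4)] and [c = cos (pi / 8)], angle doubling gives [2 s^2 = 1] and
   [2 c^2 = 1 + s]. *)
have := cos_mulr2n (pi / 8 * 1%:R : R); have := cos_mulr2n (pi / 8 * 2%:R : R).
rewrite (_ : (pi / 8 * 2%:R) *+ 2 = pi / 2 :> R); last first.
  by rewrite -mulr_natr; field.
rewrite (_ : (pi / 8 * 1%:R) *+ 2 = pi / 8 * 2%:R :> R); last first.
  by rewrite -mulr_natr; field.
rewrite cos_pihalf; set s := cos _; set c := cos _.
move=> s2 c2 s_gt0 c_gt0.
have lt_sqr (x y : R) : 0 < x -> 0 < y -> x ^+ 2 < y ^+ 2 -> x < y.
  by move=> x_gt0 y_gt0; rewrite ltr_pXn2r // nnegrE ltW.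
(* These rational bounds are sharp enough: [192 + 512 * (0.7 + 0.92)] exceeds 1021. *)
have s_ge : 7 / 10 < s by apply: lt_sqr => //; lra.
have s_le : s < 1 by apply: lt_sqr => //; lra.
have c_ge : 92 / 100 < c by apply: lt_sqr => //; lra.
have c_le : c < 1 by apply: lt_sqr => //; lra.
by lra.
Qed.

End WeightedSineSum.

(** * The state of the single edge on four vertices and its moments *)

Section CompleteEdge.
Variable R : realType.
Local Notation C := R[i].
Local Notation dim := (2 ^ 4)%N.

Fact full_edge_gt1 (e : {set 'I_4}) : e \in [set [set: 'I_4]] -> (1 < #|e|)%N.
Proof. by rewrite inE => /eqP ->; rewrite cardsT card_ord. Qed.

Fact full_edge_hyper : exists2 e, e \in [set [set: 'I_4]] & (2 < #|e|)%N.
Proof. by exists setT; rewrite ?inE // cardsT card_ord. Qed.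

Definition full_hypergraph : hypergraph 4 :=
  Hypergraph full_edge_gt1 full_edge_hyper.

Local Notation psi := (hypergraph_state R full_hypergraph).
Local Notation u := (phase_state R 4).
Local Notation top := (@Ordinal dim 15 isT).

(** The product of all four bits is 1 only for 15, as checked on the sixteen values. *)
Lemma full_hypergraph_fun (n : 'I_dim) :
  hypergraph_fun full_hypergraph n = (n == top).
Proof.
rewrite /hypergraph_fun big_set1.
rewrite (eq_bigl xpredT) => [|i]; last by rewrite inE.
rewrite !big_ord_recr big_ord0 -val_eqE; case: n => n /=.
by do 16 (case: n => [//|n]).
Qed.

Lemma sqrtC16 : sqrtC (dim%:R : C) = 4.
Proof. by rewrite (_ : dim%:R = 4 ^+ 2) ?sqrCK // -natrX. Qed.

Lemma hypergraph_stateE (n : 'I_dim) : psi n 0 = 4^-1 * (1 - 2 * (n == top)%:R).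
Proof.
rewrite mxE summxE (bigD1 n) //= !mxE !eqxx big1 ?addr0 => [|k kNn]; last first.
  by rewrite !mxE eq_sym (negPf kNn) mulr0.
rewrite full_hypergraph_fun sqrtC16 mulr1; case: (n == top) => /=.
  by congr (_ * _); ring.
by congr (_ * _); ring.
Qed.

Lemma phase_state16E m (n : 'I_dim) :
  u m n 0 = 4^-1 * expi (theta R 4 m * n%:R).
Proof. by rewrite phase_stateE sqrtC16. Qed.

Lemma theta0 : theta R 4 0 = 0.
Proof. by rewrite /theta mulr0 mul0r. Qed.

Lemma hypergraph_state_decomp : psi = u 0 - 2^-1 *: number_state R top.
Proof.
apply/colP => n; rewrite hypergraph_stateE [RHS]mxE [X in _ = _ + X]mxE
  [X in _ = _ - X]mxE.
rewrite phase_state16E theta0 mul0r expi0 [number_state _ _ _ _]mxE andbT.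
by field.
Qed.

Lemma braket_hypergraph_state v :
  braket v psi = braket v (u 0) - 2^-1 * (v top 0)^*.
Proof.
rewrite hypergraph_state_decomp braketBr [X in _ - X]braketZr.
by rewrite -(braket_conj (number_state R top)) braket_number_state.
Qed.

Lemma braket_phase_hypergraph_state (m : 'I_dim) :
  m != 0%N :> nat ->
  braket (u m) psi = - 8^-1 * (expi (theta R 4 m * 15%:R))^*.
Proof.
move=> m_neq0; rewrite braket_hypergraph_state.
rewrite (phase_state_orthonormal _ _ (Ordinal (isT : (0 < dim)%N))).
rewrite -val_eqE /= (negPf m_neq0) phase_state16E rmorphM /=.
by rewrite fmorphV rmorph_nat; field.
Qed.

Lemma braket_phase_hypergraph_state_sqr (m : 'I_dim) :
  m != 0%N :> nat -> `|braket (u m) psi| ^+ 2 = 64^-1.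
Proof.
move=> m_neq0; rewrite normCK braket_phase_hypergraph_state //.
rewrite rmorphM /= conjCK mulrACA [X in _ * X]mulrC expi_conjK mulr1.
by rewrite rmorphN fmorphV rmorph_nat /=; field.
Qed.

Lemma expectation_phase_hypergraph_state :
  expectation psi (phase_op R 4) = (15 / 64 * pi)%:C%C.
Proof.
rewrite expectation_phase_op.
(* The overlap at [m = 0] differs from the others, but its weight [theta R 4 0] is 0, so one formula
   covers all terms. *)
transitivity (\sum_(m < dim) (pi / 8 / 64 * m%:R : R)%:C%C).
  apply: eq_bigr => m _; have [m0|m_neq0] := eqVneq (m : nat) 0%N.
    by rewrite m0 theta0 mulr0 mul0r.
  rewrite braket_phase_hypergraph_state_sqr //.
  rewrite -[64^-1]/(64%:R^-1) -(rmorph_nat (real_complex R)) -fmorphV -rmorphM.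
  by rewrite /theta; congr (_%:C)%C; field.
rewrite -rmorph_sum -mulr_sumr -natr_sum; congr (_%:C)%C.
by rewrite !big_ord_recr big_ord0 /= ; field.
Qed.

Lemma expectation_phase_sqr_hypergraph_state :
  expectation psi (phase_op R 4 *m phase_op R 4) = (155 / 512 * pi ^+ 2)%:C%C.
Proof.
rewrite expectation_phase_op_sqr.
transitivity (\sum_(m < dim) ((pi / 8) ^+ 2 / 64 * (m ^ 2)%:R : R)%:C%C).
  apply: eq_bigr => m _; have [m0|m_neq0] := eqVneq (m : nat) 0%N.
    by rewrite m0 theta0 mulr0 expr0n mul0r.
  rewrite braket_phase_hypergraph_state_sqr //.
  rewrite -[64^-1]/(64%:R^-1) -(rmorph_nat (real_complex R)) -fmorphV.
  by rewrite -rmorphXn -rmorphM /theta natrX; congr (_%:C)%C; field.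
rewrite -rmorph_sum -mulr_sumr -natr_sum; congr (_%:C)%C.
by rewrite !big_ord_recr big_ord0 /= ; field.
Qed.

Lemma variance_number_hypergraph_state :
  variance psi (number_op R 4) = (85 / 4)%:C%C.
Proof.
(* The signs do not affect the moduli, so the variance is that of the uniform law on 0, ..., 15,
   namely [(16 ^ 2 - 1) / 12]. *)
have norm_psi (n : 'I_dim) : `|psi n 0| ^+ 2 = 16^-1.
  rewrite hypergraph_stateE normrM exprMn normfV normr_nat.
  have -> : `|1 - 2 * (n == top)%:R| = 1 :> C.
    case: (n == top); last by rewrite mulr0 subr0 normr1.
    by rewrite (_ : 1 - 2 * 1 = -1) ?normrN1 //; ring.
  by field.
rewrite variance_number_op.
under eq_bigr do rewrite norm_psi -natrX.
under [X in _ - X ^+ 2]eq_bigr do rewrite norm_psi.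
rewrite -!mulr_suml -!natr_sum !big_ord_recr !big_ord0 /=.
by rewrite rmorphM fmorphV !rmorph_nat; field.
Qed.

(** The real constant [15 / 64] comes from the [top] component and will cancel in the commutator;
    the sum comes from the uniform part [u 0]. *)
Lemma braket_hypergraph_number_phase (m : 'I_dim) :
  m != 0%N :> nat ->
  braket psi (number_op R 4 *m u m) * braket (u m) psi =
  15 / 64 - 128^-1 * \sum_(n < dim) n%:R * expi (theta R 4 m * n.+1%:R).
Proof.
move=> m_neq0; rewrite braket_phase_hypergraph_state //.
rewrite -braket_conj braket_hypergraph_state rmorphB /= braket_conj braketE.
rewrite !rmorphM /= conjCK fmorphV rmorph_nat number_op_mul phase_state16E /=.
set w := expi (theta R 4 m * 15%:R).
have wJ : w * w^* = 1 := expi_conjK _.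
(* Since 15 is -1 modulo 16, extracting [w] shifts [n] to [n.+1]; this [w] then cancels against the
   conjugate phase of the overlap. *)
have expiS n : expi (theta R 4 m * n%:R) = expi (theta R 4 m * n.+1%:R) * w.
  rewrite -expiD -mulrDr -natrD addSnnS natrD mulrDr expiD.
  by rewrite [theta R 4 m * 16%:R]divfK ?pow2_neq0 // expi2piMn mulr1.
set S := \sum_(n < dim) n%:R * _.
rewrite (_ : \sum_(n < dim) _ = 16^-1 * w * S); last first.
  rewrite mulr_sumr; apply: eq_bigr => n _.
  rewrite number_op_mul !phase_state16E theta0 mul0r expi0 mulr1 fmorphV.
  by rewrite rmorph_nat expiS; field.
transitivity ((15 / 64 - 128^-1 * S) * (w * w^*)); first by field.
by rewrite wJ mulr1.
Qed.

Lemma expectation_commutator_hypergraph_state :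
  expectation psi (commutator (number_op R 4) (phase_op R 4)) =
  - 'i * (pi / 512 *
    \sum_(m < dim) \sum_(n < dim) (m * n)%:R * sin8 R (m * n.+1))%:C%C.
Proof.
rewrite expectation_commutator rmorphM rmorph_sum /= mulr_sumr mulr_sumr.
apply: eq_bigr => m _; have [m0|m_neq0] := eqVneq (m : nat) 0%N.
  rewrite m0 theta0 mul0r big1 ?rmorph0 ?mulr0 // => n _.
  by rewrite mul0n mul0r.
(* Hermiticity of the number operator exhibits the second product as the conjugate of the first, so
   only [S - S^*], which is [2 * 'i] times a sine sum, remains. *)
rewrite -(braket_conj (u m) psi) -(number_op_hermitian psi) mulrC.
rewrite [X in _ - X]mulrC -rmorphM /= braket_hypergraph_number_phase //.
set S := \sum_(n < dim) n%:R * _.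
have SJ : S - S^* = 2 * 'i * (\sum_(n < dim) n%:R * sin8 R (m * n.+1))%:C%C.
  rewrite /S !rmorph_sum mulr_sumr -sumrB; apply: eq_bigr => n _ /=.
  rewrite rmorphM rmorph_nat -mulrBr [_ - _]subcJ complexiE /=.
  rewrite rmorphM rmorph_nat.
  rewrite /sin8 natrM mulrA (_ : theta R 4 m = pi / 8 * m%:R).
    by ring.
  by rewrite /theta natrX; field.
have -> : (15 / 64 - 128^-1 * S)^* = 15 / 64 - 128^-1 * S^*.
  by rewrite rmorphB !rmorphM /= !fmorphV !rmorph_nat.
transitivity (- 128^-1 * (S - S^*) * (theta R 4 m)%:C%C); first by ring.
rewrite SJ (_ : \sum_(n < dim) (m * n)%:R * _ =
  m%:R * \sum_(n < dim) n%:R * sin8 R (m * n.+1)); last first.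
  by rewrite mulr_sumr; apply: eq_bigr => n _; rewrite natrM mulrA.
set T := \sum_(n < dim) _.
transitivity (- 'i * (1 / 64 * (theta R 4 m * T))%:C%C).
  by rewrite !rmorphM fmorphV rmorph1 rmorph_nat; field.
congr (_ * _); rewrite -rmorphM; congr (_%:C)%C.
by rewrite /theta natrX; field.
Qed.

End CompleteEdge.

Theorem theorem1 (R : realType) :
  exists (d : nat) (G : hypergraph d),
    [/\ (1 <= d)%N,
        squeezed (hypergraph_state R G) (number_op R d) (phase_op R d)
          (phase_op R d)
      & variance (hypergraph_state R G) (number_op R d) >=
        uncertainty_bound (hypergraph_state R G) (number_op R d)
          (phase_op R d)].
Proof.
exists 4%N, full_hypergraph.
rewrite /squeezed variance_number_hypergraph_state /variance /uncertainty_bound.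
rewrite expectation_phase_hypergraph_state.
rewrite expectation_phase_sqr_hypergraph_state.
rewrite expectation_commutator_hypergraph_state -rmorphXn -rmorphB.
have /andP[T_gt T_le] := sum_sin8_bounds R.
set T := \sum_(m < _) _ in T_gt T_le *.
have pi_gt0 := pi_gt0 R; have pi_lt4 : pi < 4 :> R by have := pihalf_lt2 R; lra.
have bound_ge0 : 0 <= pi / 512 * T by rewrite mulr_ge0 ?divr_ge0 //; lra.
have var_phase_lt :
    155 / 512 * pi ^+ 2 - (15 / 64 * pi) ^+ 2 < 2^-1 * (pi / 512 * T).
  (* The phase variance is [1015 / 4096 * pi ^+ 2]; factoring out [pi / 1024] leaves a quantity
     positive by [T > 1015] and [pi < 4]. *)
  rewrite -subr_gt0 [X in 0 < X](_ : _ = pi / 1024 * (T - 1015 / 4 * pi)).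
    by rewrite mulr_gt0 ?divr_gt0 // subr_gt0; lra.
  by field.
have var_number_ge : 2^-1 * (pi / 512 * T) <= 85 / 4.
  have : pi * T <= 4 * 1216 by rewrite ler_pM //; lra.
  by lra.
(* The commutator expectation is [- 'i] times a nonnegative real, so its modulus is that real and
   both claims become real inequalities. *)
rewrite normrM normrN normCi mul1r ger0_norm; last by rewrite ler0c.
rewrite -(rmorph_nat (real_complex R)) -fmorphV -rmorphM lecR ltcR.
by split.
Qed.
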